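(* Let $\mathcal{H}_A,\mathcal{H}_B,\mathcal{H}_C$ be finite-dimensional Hilbert spaces and let $\rho_{ABC}$ be a triangle-compatible state on $\mathcal{H}_A\otimes\mathcal{H}_B\otimes\mathcal{H}_C$. Then for all pairwise distinct $x,y,z\in\{A,B,C\}$, $$I_{xy}(\rho_{ABC}):=\mathbb{1}-\rho_x-\rho_y-\rho_z+\rho_x\otimes\rho_y+\rho_{xz}+\rho_{yz}\ \ge\ 0 ,$$ i.e. $I_{xy}(\rho_{ABC})$ is positive semidefinite.
   Context: A state is a positive semidefinite operator of unit trace; $\rho_x$, $\rho_{xz}$, etc. denote reduced states (partial traces) of $\rho_{ABC}$. Tensor products with identity operators are suppressed: every term in $I_{xy}(\rho_{ABC})$ is an operator on $\mathcal{H}_A\otimes\mathcal{H}_B\otimes\mathcal{H}_C$. A state $\rho_{ABC}$ is triangle-compatible if there exist finite-dimensional Hilbert spaces (of arbitrary dimension) $\mathcal{H}_{L^{(A)}},\mathcal{H}_{L^{(C)}},\mathcal{H}_{M^{(A)}},\mathcal{H}_{M^{(B)}},\mathcal{H}_{N^{(B)}},\mathcal{H}_{N^{(C)}}$, states $\varrho_{L^{(A)}L^{(C)}}$, $\varrho_{M^{(A)}M^{(B)}}$, $\varrho_{N^{(B)}N^{(C)}}$ on the corresponding tensor products, and quantum channels (completely positive trace-preserving maps) $\mathcal{E}_A:L^{(A)}M^{(A)}\to A$, $\mathcal{E}_B:M^{(B)}N^{(B)}\to B$, $\mathcal{E}_C:L^{(C)}N^{(C)}\to C$ such that (after the obvious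 reordering of tensor factors) $$\rho_{ABC}=(\mathcal{E}_A\otimes\mathcal{E}_B\otimes\mathcal{E}_C)\big(\varrho_{L^{(A)}L^{(C)}}\otimes\varrho_{M^{(A)}M^{(B)}}\otimes\varrho_{N^{(B)}N^{(C)}}\big).$$ *)

(* Defs.v *)
From mathcomp Require Export all_boot all_order all_algebra.
From mathcomp Require Export spectral reals.
From mathcomp.real_closed Require Export complex mxtens.

Set Implicit Arguments.
Unset Strict Implicit.
Unset Printing Implicit Defensive.

Import Order.TTheory GRing.Theory Num.Theory.
Local Open Scope ring_scope.
Local Open Scope sesquilinear_scope.

(* A Hilbert space of dimension n is C^n with its standard basis; an operator
   on it is a square matrix. The basis of a tensor product of spaces of
   dimensions m and n is numbered by [mxtens_index : 'I_m * 'I_n -> 'I_(m * n)],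
   so that the tensor product of operators is the Kronecker product
   [tensmx], written [*t]. *)

Definition psd (C : numClosedFieldType) n (X : 'M[C]_n) : Prop :=
  X ^t* = X /\ forall v : 'cV[C]_n, 0 <= (v ^t* *m X *m v) 0 0.

Definition is_state (C : numClosedFieldType) n (X : 'M[C]_n) : Prop :=
  psd X /\ \tr X = 1.

(* For linear E and F this is the linear map E (x) F, i.e. the linear map
   sending X *t Y to E X *t F Y; it is given by its values on the matrix
   units delta_mx i j *t delta_mx k l. *)
Definition tensmap (C : numClosedFieldType) m m' n n'
    (E : 'M[C]_m -> 'M[C]_m') (F : 'M[C]_n -> 'M[C]_n')
    (X : 'M[C]_(m * n)) : 'M[C]_(m' * n') :=
  \sum_(i < m) \sum_(j < m) \sum_(k < n) \sum_(l < n)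
    X (mxtens_index (i, k)) (mxtens_index (j, l))
      *: (E (delta_mx i j) *t F (delta_mx k l)).

Definition completely_positive (C : numClosedFieldType) m n
    (E : {linear 'M[C]_m -> 'M[C]_n}) : Prop :=
  forall (k : nat) (X : 'M[C]_(m * k)), psd X -> psd (tensmap E id X).

Definition trace_preserving (C : numClosedFieldType) m n
    (E : {linear 'M[C]_m -> 'M[C]_n}) : Prop :=
  forall X : 'M[C]_m, \tr (E X) = \tr X.

Definition channel (C : numClosedFieldType) m n
    (E : {linear 'M[C]_m -> 'M[C]_n}) : Prop :=
  completely_positive E /\ trace_preserving E.

(* Position in (L^A (x) L^C) (x) (M^A (x) M^B) (x) (N^B (x) N^C) of the basis
   vector with number k in (L^A (x) M^A) (x) (M^B (x) N^B) (x) (L^C (x) N^C). *)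
Definition triangle_index la lc ma mb nb nc
    (k : 'I_(la * ma * (mb * nb) * (lc * nc))) :
    'I_(la * lc * (ma * mb) * (nb * nc)) :=
  let: (kab, kc) := mxtens_unindex k in
  let: (ka, kb) := mxtens_unindex kab in
  let: (iLA, iMA) := mxtens_unindex ka in
  let: (iMB, iNB) := mxtens_unindex kb in
  let: (iLC, iNC) := mxtens_unindex kc in
  mxtens_index
    (mxtens_index (mxtens_index (iLA, iLC), mxtens_index (iMA, iMB)),
     mxtens_index (iNB, iNC)).

Definition triangle_reorder (C : numClosedFieldType) la lc ma mb nb nc
    (X : 'M[C]_(la * lc * (ma * mb) * (nb * nc))) :
    'M[C]_(la * ma * (mb * nb) * (lc * nc)) :=
  mxsub (@triangle_index la lc ma mb nb nc)
        (@triangle_index la lc ma mb nb nc) X.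

Definition triangle_compatible (C : numClosedFieldType) a b c
    (rho : 'M[C]_(a * b * c)) : Prop :=
  exists la lc ma mb nb nc : nat,
  exists (sL : 'M[C]_(la * lc)) (sM : 'M[C]_(ma * mb)) (sN : 'M[C]_(nb * nc)),
  exists (EA : {linear 'M[C]_(la * ma) -> 'M[C]_a})
         (EB : {linear 'M[C]_(mb * nb) -> 'M[C]_b})
         (EC : {linear 'M[C]_(lc * nc) -> 'M[C]_c}),
  [/\ [/\ is_state sL, is_state sM & is_state sN],
      [/\ channel EA, channel EB & channel EC] &
      rho = tensmap (tensmap EA EB) EC (triangle_reorder (sL *t sM *t sN))].

(* If k |-> (keep k, out k) is a bijection from the basis of the whole space to
   pairs of basis vectors of two tensor factors, this is the partial trace over
   the second factor: each of the two inner sums then has exactly one term. *)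
Definition ptrace (C : numClosedFieldType) n m r
    (keep : 'I_n -> 'I_m) (out : 'I_n -> 'I_r) (X : 'M[C]_n) : 'M[C]_m :=
  \matrix_(i, j) \sum_(o < r)
    \sum_(k | (keep k == i) && (out k == o))
      \sum_(l | (keep l == j) && (out l == o)) X k l.

Inductive party := partyA | partyB | partyC.

Section Reduced.
Variables (C : numClosedFieldType) (d : party -> nat).

Local Notation dABC := (d partyA * d partyB * d partyC)%N.

Definition factor (p : party) : 'I_dABC -> 'I_(d p) :=
  match p with
  | partyA => fun k => (mxtens_unindex (mxtens_unindex k).1).1
  | partyB => fun k => (mxtens_unindex (mxtens_unindex k).1).2
  | partyC => fun k => (mxtens_unindex k).2
  end.

Definition factor2 (x y : party) (k : 'I_dABC) : 'I_(d x * d y) :=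
  mxtens_index (factor x k, factor y k).

Definition factor3 (x y z : party) (k : 'I_dABC) : 'I_(d x * d y * d z) :=
  mxtens_index (factor2 x y k, factor z k).

(* In all that follows x, y, z are meant to be pairwise distinct. *)

(* rho_x, with y and z traced out *)
Definition reduced1 (x y z : party) (rho : 'M[C]_dABC) : 'M[C]_(d x) :=
  ptrace (factor x) (factor2 y z) rho.

(* rho_xy, with z traced out *)
Definition reduced2 (x y z : party) (rho : 'M[C]_dABC) : 'M[C]_(d x * d y) :=
  ptrace (factor2 x y) (factor z) rho.

(* An operator on H_x (x) H_y (x) H_z, with its tensor factors put back in the
   order A, B, C. *)
Definition toABC (x y z : party) (X : 'M[C]_(d x * d y * d z)) : 'M[C]_dABC :=
  mxsub (factor3 x y z) (factor3 x y z) X.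

Definition on1 (x y z : party) (X : 'M[C]_(d x)) : 'M[C]_dABC :=
  toABC (X *t (1%:M : 'M_(d y)) *t (1%:M : 'M_(d z))).

Definition on2 (x y z : party) (X : 'M[C]_(d x * d y)) : 'M[C]_dABC :=
  toABC (X *t (1%:M : 'M_(d z))).

Definition Ixy (x y z : party) (rho : 'M[C]_dABC) : 'M[C]_dABC :=
  1%:M - on1 y z (reduced1 x y z rho)
       - on1 x z (reduced1 y x z rho)
       - on1 x y (reduced1 z x y rho)
       + on2 z (reduced1 x y z rho *t reduced1 y x z rho)
       + on2 y (reduced2 x z y rho)
       + on2 x (reduced2 y z x rho).

End Reduced.

(* Main.v *)
(** Let z be the third party and cut the source shared by x and y: let it emit
    two independent systems with the same reduced states. The network then
    produces a state tau with tau_xy = rho_x (x) rho_y, while tau_xz = rho_xz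
    and tau_yz = rho_yz since channels preserve the trace. Hence I_xy(rho) is
    the sum of tau and of the universal state inversion
    [1 - tau_x - tau_y - tau_z + tau_xy + tau_xz + tau_yz - tau], and both are
    positive. The inversion is positive because, for tau = psi psi^*, its
    quadratic form at v is, up to a factor, the squared norm of the
    antisymmetrization of psi (x) v under the three swaps of tensor factors. *)

Require Import Defs.
From mathcomp Require Import ring.

Set Implicit Arguments.
Unset Strict Implicit.
Unset Printing Implicit Defensive.

Import Order.TTheory GRing.Theory Num.Theory.
Local Open Scope ring_scope.
Local Open Scope sesquilinear_scope.

(** * Positive semidefinite kernels *)

Section Gram.
Variable C : numClosedFieldType.

(** Positive semidefiniteness in factored form. The index set is any finite type, so that tensor
    factors are components of tuples and each closure property below is read off from the family
    [f]. *)
Definition gram (T : finType) (K : T -> T -> C) : Prop :=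
  exists (I : finType) (f : I -> T -> C),
    forall s t, K s t = \sum_i f i s * (f i t)^*.

Lemma eq_gram (T : finType) (K L : T -> T -> C) :
  (forall s t, K s t = L s t) -> gram K -> gram L.
Proof. by move=> KL [I [f fE]]; exists I, f => s t; rewrite -KL. Qed.

Lemma gram_pullback (S T : finType) (h : S -> T) (K : T -> T -> C) :
  gram K -> gram (fun s t => K (h s) (h t)).
Proof. by case=> I [f fE]; exists I, (fun i s => f i (h s)) => s t; apply: fE. Qed.

(** Schur's product theorem, with the products of the two families as factors. Combined with
    pullbacks along projections it also gives tensor products. *)
Lemma gramM (T : finType) (K L : T -> T -> C) :
  gram K -> gram L -> gram (fun s t => K s t * L s t).
Proof.
case=> I [f fE] [J [g gE]].
exists (I * J)%type, (fun ij s => f ij.1 s * g ij.2 s) => s t.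
rewrite fE gE big_distrlr /= pair_bigA /=.
by apply: eq_bigr => ij _; rewrite rmorphM /=; ring.
Qed.

(** A congruence: row and column indices are summed independently, so each factor is simply summed
    over [u]. In [gram_trace] the two indices are tied, as in a partial trace, and [u] joins the
    index of the family. *)
Lemma gram_contract (S T U : finType) (h : U -> S -> T) (K : T -> T -> C) :
  gram K -> gram (fun s t => \sum_u \sum_u' K (h u s) (h u' t)).
Proof.
case=> I [f fE]; exists I, (fun i s => \sum_u f i (h u s)) => s t.
under eq_bigr => u _ do (under eq_bigr => u' _ do rewrite fE; rewrite exchange_big).
rewrite exchange_big; apply: eq_bigr => i _ /=.
by rewrite rmorph_sum big_distrlr.
Qed.

Lemma gram_trace (S T U : finType) (h : U -> S -> T) (K : T -> T -> C) :
  gram K -> gram (fun s t => \sum_u K (h u s) (h u t)).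
Proof.
case=> I [f fE]; exists (U * I)%type, (fun ui s => f ui.2 (h ui.1 s)) => s t.
by rewrite -(pair_bigA _ (fun u i => f i (h u s) * (f i (h u t))^*)) /=;
   apply: eq_bigr => u _; apply: fE.
Qed.

Lemma gram_form_ge0 (T : finType) (K : T -> T -> C) (v : T -> C) :
  gram K -> 0 <= \sum_s \sum_t (v s)^* * K s t * v t.
Proof.
case=> I [f fE].
have -> : \sum_s \sum_t (v s)^* * K s t * v t
    = \sum_i (\sum_s (v s)^* * f i s) * (\sum_s (v s)^* * f i s)^*.
  under eq_bigr => s _ do under eq_bigr => t _ do rewrite fE mulr_sumr mulr_suml.
  under eq_bigr => s _ do rewrite exchange_big.
  rewrite exchange_big; apply: eq_bigr => i _ /=.
  rewrite rmorph_sum big_distrlr; apply: eq_bigr => s _; apply: eq_bigr => t _ /=.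
  by rewrite rmorphM /= conjCK; ring.
by apply: sumr_ge0 => i _; apply: mul_conjC_ge0.
Qed.

(** By the spectral theorem, the eigenvectors scaled by the square roots of the eigenvalues are the
    factors. *)
Lemma psd_gram n (X : 'M[C]_n) : psd X -> gram (fun s t => X s t).
Proof.
case=> hX X_ge0.
have /orthomx_spectralP XE : X \is normalmx by apply/normalmxP; rewrite hX.
move: XE; set P := spectralmx X; set d := spectral_diag X.
have PU : P \is unitarymx by apply: spectral_unitarymx.
rewrite invmx_unitary // => XE.
(* The eigenvalue is the value of the quadratic form at the corresponding eigenvector, a column of
   the adjoint of [P]. *)
have d_ge0 i : 0 <= d 0 i.
  have := X_ge0 (P^t* *m delta_mx i 0).
  rewrite trmx_mul map_mxM trmxCK {1}XE !mulmxA.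
  rewrite mulmxtVK // mulmxtVK // trmx_delta map_delta_mx -rowE -colE !mxE.
  by rewrite eqxx mulr1n.
exists 'I_n, (fun i s => sqrtC (d 0 i) * (P i s)^*) => s t.
rewrite {1}XE -mulmxA mxE; apply: eq_bigr => i _.
rewrite mul_diag_mx !mxE rmorphM /= conjCK.
have /conj_Creal -> : sqrtC (d 0 i) \is Num.real by rewrite ger0_real ?sqrtC_ge0.
by rewrite -[in LHS](sqrtCK (d 0 i)) expr2; ring.
Qed.

End Gram.

(** * Universal state inversion *)

Section Inversion.
Variables (C : numClosedFieldType) (X Y Z : finType).
Local Notation T := (X * Y * Z)%type.
Local Notation mask := (bool * bool * bool)%type.

Definition mix (b : mask) (s t : T) : T :=
  (if b.1.1 then s.1.1 else t.1.1,
   if b.1.2 then s.1.2 else t.1.2,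
   if b.2 then s.2 else t.2).

(** The factors marked by [b] are exchanged between two copies of the system. These swaps form an
    action of the group (Z/2)^3, whose product is [xormask]; [sgn] is its character that is -1 on
    each single swap. *)
Definition swap (b : mask) (p : T * T) : T * T := (mix b p.2 p.1, mix b p.1 p.2).

Definition xormask (b c : mask) : mask :=
  (b.1.1 (+) c.1.1, b.1.2 (+) c.1.2, b.2 (+) c.2).

Definition sgn (b : mask) : C := (-1) ^+ (b.1.1 (+) b.1.2 (+) b.2).

Lemma swap_comp b c p : swap b (swap c p) = swap (xormask b c) p.
Proof.
case: b c p => [[b1 b2] b3] [[c1 c2] c3] [[[s1 s2] s3] [[t1 t2] t3]].
by case: b1; case: b2; case: b3; case: c1; case: c2; case: c3.
Qed.

Lemma xormaskK b : involutive (xormask b).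
Proof. by case: b => [[b1 b2] b3] [[c1 c2] c3]; rewrite /xormask /= !addKb. Qed.

Lemma swapK b : involutive (swap b).
Proof.
move=> p; rewrite swap_comp.
case: b p => [[b1 b2] b3] [[[s1 s2] s3] [[t1 t2] t3]].
by rewrite /swap /mix /xormask /= !addbb.
Qed.

Lemma sgn_xor b c : sgn (xormask b c) = sgn b * sgn c.
Proof.
rewrite /sgn -signr_addb; congr (_ ^+ nat_of_bool _).
case: b c => [[b1 b2] b3] [[c1 c2] c3].
by case: b1; case: b2; case: b3; case: c1; case: c2; case: c3.
Qed.

(* Up to the factor 8, [\sum_b sgn b *: swap b] is the orthogonal projection
   onto the functions that are odd under each of the three swaps. *)
Lemma antisym_form_ge0 (F : T * T -> C) :
  0 <= \sum_b sgn b * \sum_p (F p)^* * F (swap b p).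
Proof.
set Q := \sum_b _.
(* The squared norm of the antisymmetrized function is a double sum over masks; each of the eight
   masks [c] will contribute one copy of [Q]. *)
suff Q8 : \sum_p (\sum_b sgn b * F (swap b p)) * (\sum_b sgn b * F (swap b p))^*
          = Q *+ #|{: mask}|.
  have : 0 <= Q *+ #|{: mask}| by rewrite -Q8; apply: sumr_ge0 => p _; apply: mul_conjC_ge0.
  by rewrite pmulrn_lge0 // !card_prod card_bool.
have sgnJ b : (sgn b)^* = sgn b by rewrite rmorph_sign.
transitivity (\sum_(c : mask) Q); last by rewrite sumr_const.
transitivity (\sum_(c : mask) \sum_(b : mask) \sum_p
    sgn b * sgn c * ((F (swap c p))^* * F (swap b p))).
  under eq_bigr => p _ do rewrite rmorph_sum big_distrlr exchange_big.
  rewrite exchange_big; apply: eq_bigr => c _ /=.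
  rewrite exchange_big; apply: eq_bigr => b _ /=.
  by apply: eq_bigr => p _; rewrite rmorphM /= sgnJ; ring.
apply: eq_bigr => c _.
(* Translating both the mask and the point by [c] removes [c] from the arguments of [F], and the two
   signs of [c] cancel. *)
rewrite (reindex_inj (inv_inj (@xormaskK c))); apply: eq_bigr => b _.
rewrite mulr_sumr (reindex_inj (inv_inj (@swapK c))).
apply: eq_bigr => p _ /=.
rewrite swapK swap_comp.
have -> : xormask (xormask c b) c = b.
  case: b c => [[b1 b2] b3] [[c1 c2] c3].
  by rewrite /xormask /= ![c1 (+) _]addbC ![c2 (+) _]addbC ![c3 (+) _]addbC !addbK.
rewrite sgn_xor (mulrC (sgn c)) -(mulrA (sgn b)).
by rewrite /sgn -expr2 sqrr_sign mulr1.
Qed.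

(** The reduced kernel on the parties marked by [b], tensored with the identity on the others. It is
    written with [mix] so that it is visibly the partial trace of a swap applied to two copies. *)
Definition marginal b (K : T -> T -> C) (s t : T) : C :=
  \sum_i (mix b i s == t)%:R * K (mix b s i) i.

(** By linearity [K] may be split into rank-one kernels; for the factor [f r] the sum is the
    antisymmetrized form at the tensor product of [f r] and [v]. *)
Lemma universal_inversion (K : T -> T -> C) (v : T -> C) : gram K ->
  0 <= \sum_b sgn b * \sum_s \sum_t (v s)^* * marginal b K s t * v t.
Proof.
case=> I [f fE].
have -> : \sum_b sgn b * \sum_s \sum_t (v s)^* * marginal b K s t * v t
    = \sum_r \sum_b sgn b * \sum_p (f r p.1 * v p.2)^* *
         (f r (swap b p).1 * v (swap b p).2).
  rewrite exchange_big; apply: eq_bigr => b _ /=.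
  rewrite -mulr_sumr; congr (_ * _); rewrite [RHS]exchange_big /=.
  rewrite -(pair_bigA _ (fun i s => \sum_r (f r i * v s)^* * (f r (mix b s i) * v (mix b i s)))) /=.
  rewrite [RHS]exchange_big; apply: eq_bigr => s _ /=.
  under eq_bigr => t _ do rewrite mulr_sumr mulr_suml.
  rewrite exchange_big; apply: eq_bigr => i _ /=.
  rewrite (bigD1 (mix b i s)) //= eqxx big1 ?addr0; last first.
    by move=> t /negPf; rewrite eq_sym => ->; rewrite mul0r mulr0 mul0r.
  rewrite mul1r fE mulr_sumr mulr_suml; apply: eq_bigr => r _.
  by rewrite rmorphM /=; ring.
by apply: sumr_ge0 => r _; apply: antisym_form_ge0 (fun p => f r p.1 * v p.2).
Qed.

(** * Reduced kernels in explicit form *)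

Definition marg1 (K : T -> T -> C) a a' := \sum_b \sum_c K (a, b, c) (a', b, c).
Definition marg2 (K : T -> T -> C) b b' := \sum_a \sum_c K (a, b, c) (a, b', c).
Definition marg3 (K : T -> T -> C) c c' := \sum_a \sum_b K (a, b, c) (a, b, c').
Definition marg12 (K : T -> T -> C) a b a' b' := \sum_c K (a, b, c) (a', b', c).
Definition marg13 (K : T -> T -> C) a c a' c' := \sum_b K (a, b, c) (a', b, c').
Definition marg23 (K : T -> T -> C) b c b' c' := \sum_a K (a, b, c) (a, b', c').

(** The universal inversion without its term [- K]. The identity carries the trace of [K], which
    keeps the expression linear in [K]. *)
Definition Ikernel (K : T -> T -> C) (s t : T) : C :=
  let: (a, b, c) := s in let: (a', b', c') := t in
  let da := (a == a')%:R in let db := (b == b')%:R in let dc := (c == c')%:R in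
  da * db * dc * \sum_i K i i
  - marg1 K a a' * db * dc - marg2 K b b' * da * dc - marg3 K c c' * da * db
  + marg12 K a b a' b' * dc + marg13 K a c a' c' * db + marg23 K b c b' c' * da.

Lemma sum_triple (F : T -> C) : \sum_t F t = \sum_a \sum_b \sum_c F (a, b, c).
Proof. by rewrite pair_bigA pair_bigA /=; apply: eq_bigr => -[[a b] c]. Qed.

Lemma sum_delta (J : finType) (j : J) (F : J -> C) : \sum_i (i == j)%:R * F i = F j.
Proof.
rewrite (bigD1 j) //= eqxx mul1r big1 ?addr0 // => i /negPf ->.
by rewrite mul0r.
Qed.

(** With one delta per nested sum, [sum_delta] can eliminate the variables of the marked parties one
    at a time. *)
Lemma marginalE m1 m2 m3 K a b c a' b' c' :
  marginal (m1, m2, m3) K (a, b, c) (a', b', c') =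
  \sum_a1 ((if m1 then a1 else a) == a')%:R *
    \sum_b1 ((if m2 then b1 else b) == b')%:R *
      \sum_c1 ((if m3 then c1 else c) == c')%:R *
         K (if m1 then a else a1, if m2 then b else b1, if m3 then c else c1)
           (a1, b1, c1).
Proof.
rewrite /marginal sum_triple; apply: eq_bigr => a1 _.
rewrite mulr_sumr; apply: eq_bigr => b0 _.
rewrite !mulr_sumr; apply: eq_bigr => c1 _.
by rewrite /mix /= !xpair_eqE -!mulnb !natrM; ring.
Qed.

(** The full mask has sign -1 and marginal [K], so the added [K] cancels it; the other seven masks
    give the seven terms of [Ikernel]. *)
Lemma Ikernel_marginals K s t :
  Ikernel K s t = \sum_b sgn b * marginal b K s t + K s t.
Proof.
case: s t => [[a b] c] [[a' b'] c'].
have -> : \sum_m sgn m * marginal m K (a, b, c) (a', b', c') =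
    \sum_m1 \sum_m2 \sum_m3
      sgn (m1, m2, m3) * marginal (m1, m2, m3) K (a, b, c) (a', b', c').
  by rewrite pair_bigA pair_bigA /=; apply: eq_bigr => -[[m1 m2] m3] _.
rewrite !big_bool /sgn /= !expr0 !expr1 !mulN1r !mul1r.
have -> : marginal (true, true, true) K (a, b, c) (a', b', c') = K (a, b, c) (a', b', c').
  by rewrite marginalE !sum_delta.
have -> : marginal (true, true, false) K (a, b, c) (a', b', c')
    = (c == c')%:R * marg12 K a b a' b'.
  by rewrite marginalE !sum_delta -mulr_sumr.
have -> : marginal (true, false, true) K (a, b, c) (a', b', c')
    = (b == b')%:R * marg13 K a c a' c'.
  rewrite marginalE sum_delta /= -mulr_sumr; congr (_ * _).
  by apply: eq_bigr => b1 _; rewrite sum_delta.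
have -> : marginal (false, true, true) K (a, b, c) (a', b', c')
    = (a == a')%:R * marg23 K b c b' c'.
  rewrite marginalE /= -mulr_sumr; congr (_ * _).
  by apply: eq_bigr => a1 _; rewrite !sum_delta.
have -> : marginal (true, false, false) K (a, b, c) (a', b', c')
    = (b == b')%:R * (c == c')%:R * marg1 K a a'.
  rewrite marginalE sum_delta /= -mulr_sumr -mulrA; congr (_ * _).
  by rewrite mulr_sumr; apply: eq_bigr => b1 _; rewrite -mulr_sumr.
have -> : marginal (false, true, false) K (a, b, c) (a', b', c')
    = (a == a')%:R * (c == c')%:R * marg2 K b b'.
  rewrite marginalE /= -mulr_sumr -mulrA; congr (_ * _).
  by rewrite mulr_sumr; apply: eq_bigr => a1 _; rewrite sum_delta -mulr_sumr.
have -> : marginal (false, false, true) K (a, b, c) (a', b', c')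
    = (a == a')%:R * (b == b')%:R * marg3 K c c'.
  rewrite marginalE /= -mulr_sumr -mulrA; congr (_ * _).
  rewrite mulr_sumr; apply: eq_bigr => a1 _; rewrite -mulr_sumr; congr (_ * _).
  by apply: eq_bigr => b1 _; rewrite sum_delta.
have -> : marginal (false, false, false) K (a, b, c) (a', b', c')
    = (a == a')%:R * (b == b')%:R * (c == c')%:R * \sum_i K i i.
  rewrite marginalE /= sum_triple -mulr_sumr -!mulrA; congr (_ * _).
  rewrite !mulr_sumr; apply: eq_bigr => a1 _; rewrite -mulr_sumr; congr (_ * _).
  by rewrite mulr_sumr; apply: eq_bigr => b1 _; rewrite -mulr_sumr.
by rewrite /Ikernel; ring.
Qed.

Lemma Ikernel_form_ge0 (K : T -> T -> C) (v : T -> C) : gram K ->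
  0 <= \sum_s \sum_t (v s)^* * Ikernel K s t * v t.
Proof.
move=> Kg; have Ige0 := universal_inversion v Kg; have Kge0 := gram_form_ge0 v Kg.
suff -> : \sum_s \sum_t (v s)^* * Ikernel K s t * v t =
    \sum_b sgn b * (\sum_s \sum_t (v s)^* * marginal b K s t * v t) +
    \sum_s \sum_t (v s)^* * K s t * v t by apply: addr_ge0.
under [X in X + _]eq_bigr => b _ do rewrite mulr_sumr.
rewrite [X in X + _]exchange_big -big_split /=; apply: eq_bigr => s _.
under [X in X + _]eq_bigr => b _ do rewrite mulr_sumr.
rewrite [X in X + _]exchange_big -big_split /=; apply: eq_bigr => t _.
rewrite Ikernel_marginals mulrDr mulrDl mulr_sumr mulr_suml; congr (_ + _).
by apply: eq_bigr => b _; ring.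
Qed.

End Inversion.

(** * The triangle network *)

Section Network.
Variable C : numClosedFieldType.

Definition unit_trace_gram (T : finType) (S : T -> T -> C) : Prop :=
  gram S /\ \sum_t S t t = 1.

(* [J (i, a) (i', a')] is the [(a, a')] entry of the image of the matrix unit
   at [(i, i')], that is, [J] is the Choi matrix of a channel. *)
Definition choi_channel (I A : finType) (J : I * A -> I * A -> C) : Prop :=
  gram J /\ forall i i', \sum_a J (i, a) (i', a) = (i == i')%:R.

Lemma choi_channel_pullback (I I' A : finType) (h : I' -> I)
    (J : I * A -> I * A -> C) : injective h -> choi_channel J ->
  choi_channel (fun s t => J (h s.1, s.2) (h t.1, t.2)).
Proof.
move=> hI [gJ JE]; split; first exact: (gram_pullback (fun s => (h s.1, s.2)) gJ).
by move=> i i'; rewrite /= JE (inj_eq hI).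
Qed.

Lemma unit_trace_gram_pullback (T T' : finType) (h : T' -> T)
    (S : T -> T -> C) : bijective h -> unit_trace_gram S ->
  unit_trace_gram (fun s t => S (h s) (h t)).
Proof.
move=> hb [gS SE]; split; first exact: gram_pullback.
by rewrite -[RHS]SE [RHS](reindex h) //; apply: onW_bij.
Qed.

Section Parties.
Variables X Y Z : finType.
Local Notation T := (X * Y * Z)%type.

(** The network in coordinates: three sources contracted with the Choi kernels of three channels.
    [SM] is shared by the first and second party, [SL] by the first and third, [SN] by the second
    and third; [w] and [w'] are the row and column indices of all sources. *)
Definition triangle_kernel (K : T -> T -> C) : Prop :=
  exists (P P' Q Q' R R' : finType)
    (SM : P * P' -> P * P' -> C) (SL : Q * Q' -> Q * Q' -> C)
    (SN : R * R' -> R * R' -> C)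
    (JX : P * Q * X -> P * Q * X -> C) (JY : P' * R * Y -> P' * R * Y -> C)
    (JZ : Q' * R' * Z -> Q' * R' * Z -> C),
  [/\ [/\ unit_trace_gram SM, unit_trace_gram SL & unit_trace_gram SN],
      [/\ choi_channel JX, choi_channel JY & choi_channel JZ] &
      forall a b c a' b' c', K (a, b, c) (a', b', c') =
        \sum_(w : (P * P') * (Q * Q') * (R * R'))
        \sum_(w' : (P * P') * (Q * Q') * (R * R'))
          SM w.1.1 w'.1.1 * SL w.1.2 w'.1.2 * SN w.2 w'.2 *
          (JX (w.1.1.1, w.1.2.1, a) (w'.1.1.1, w'.1.2.1, a') *
           JY (w.1.1.2, w.2.1, b) (w'.1.1.2, w'.2.1, b') *
           JZ (w.1.2.2, w.2.2, c) (w'.1.2.2, w'.2.2, c'))].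

End Parties.

(** * Permuting the parties of the network *)

Definition pswap (A B : Type) (p : A * B) : B * A := (p.2, p.1).

Lemma pswap_bij (A B : Type) : bijective (@pswap A B).
Proof. by exists (@pswap B A) => -[]. Qed.

(** The source shared by the exchanged parties is turned over and the two other sources trade
    places, so the third channel reads its inputs in the opposite order. With
    [triangle_kernel_swap23] this generates all permutations, and only the first pair has to be
    cut. *)
Lemma triangle_kernel_swap12 (X Y Z : finType) (K : X * Y * Z -> X * Y * Z -> C) :
  triangle_kernel K ->
  triangle_kernel (fun s t : Y * X * Z =>
    K (s.1.2, s.1.1, s.2) (t.1.2, t.1.1, t.2)).
Proof.
case=> P [P' [Q [Q' [R [R' [SM [SL [SN [JX [JY [JZ]]]]]]]]]]].
case=> -[hM hL hN] [hX hY hZ] KE.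
exists P', P, R, R', Q, Q', (fun s t => SM (pswap s) (pswap t)), SN, SL, JY, JX,
  (fun s t => JZ (pswap s.1, s.2) (pswap t.1, t.2)); split.
- by split=> //; apply: unit_trace_gram_pullback => //; apply: pswap_bij.
- by split=> //; apply: choi_channel_pullback => //; apply: bij_inj (@pswap_bij _ _).
move=> b a c b' a' c'; rewrite KE.
pose h (w : P' * P * (R * R') * (Q * Q')) : P * P' * (Q * Q') * (R * R') :=
  (pswap w.1.1, w.2, w.1.2).
have hb : bijective h.
  by exists (fun w => (pswap w.1.1, w.2, w.1.2)) => -[[[? ?] ?] ?].
rewrite (reindex h) /=; last exact: onW_bij.
apply: eq_bigr => w _; rewrite (reindex h) /=; last exact: onW_bij.
by apply: eq_bigr => w' _; rewrite /pswap /=; ring.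
Qed.

Lemma triangle_kernel_swap23 (X Y Z : finType) (K : X * Y * Z -> X * Y * Z -> C) :
  triangle_kernel K ->
  triangle_kernel (fun s t : X * Z * Y =>
    K (s.1.1, s.2, s.1.2) (t.1.1, t.2, t.1.2)).
Proof.
case=> P [P' [Q [Q' [R [R' [SM [SL [SN [JX [JY [JZ]]]]]]]]]]].
case=> -[hM hL hN] [hX hY hZ] KE.
exists Q, Q', P, P', R', R, SL, SM, (fun s t => SN (pswap s) (pswap t)),
  (fun s t => JX (pswap s.1, s.2) (pswap t.1, t.2)), JZ, JY; split.
- by split=> //; apply: unit_trace_gram_pullback => //; apply: pswap_bij.
- by split=> //; apply: choi_channel_pullback => //; apply: bij_inj (@pswap_bij _ _).
move=> a c b a' c' b'; rewrite KE.
pose h (w : Q * Q' * (P * P') * (R' * R)) : P * P' * (Q * Q') * (R * R') :=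
  (w.1.2, w.1.1, pswap w.2).
have hb : bijective h.
  by exists (fun w => (w.1.2, w.1.1, pswap w.2)) => -[[? ?] [? ?]].
rewrite (reindex h) /=; last exact: onW_bij.
apply: eq_bigr => w _; rewrite (reindex h) /=; last exact: onW_bij.
by apply: eq_bigr => w' _; rewrite /pswap /=; ring.
Qed.

(** * Contractions with one half of a source *)

Lemma sum_pair (A B : finType) (F : A * B -> C) :
  \sum_w F w = \sum_a \sum_b F (a, b).
Proof. by rewrite pair_bigA; apply: eq_bigr => -[]. Qed.

(** A delta on one half of a source traces that half out and leaves the reduced kernel of the
    other. *)
Lemma sum_pair_delta2 (P P' : finType) (S : P * P' -> P * P' -> C)
    (h : P -> P -> C) :
  \sum_m \sum_m' S m m' * ((m.2 == m'.2)%:R * h m.1 m'.1) =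
  \sum_p \sum_p' (\sum_q S (p, q) (p', q)) * h p p'.
Proof.
rewrite sum_pair; apply: eq_bigr => p _.
under eq_bigr => q _ do rewrite sum_pair.
rewrite exchange_big; apply: eq_bigr => p' _ /=; rewrite mulr_suml.
apply: eq_bigr => q _; rewrite -(sum_delta q (fun q' => S (p, q) (p', q') * h p p')).
by apply: eq_bigr => q' _; rewrite eq_sym; ring.
Qed.

Lemma sum_pair_delta1 (P P' : finType) (S : P * P' -> P * P' -> C)
    (h : P' -> P' -> C) :
  \sum_m \sum_m' S m m' * ((m.1 == m'.1)%:R * h m.2 m'.2) =
  \sum_q \sum_q' (\sum_p S (p, q) (p, q')) * h q q'.
Proof.
rewrite -[RHS](sum_pair_delta2 (fun m m' => S (pswap m) (pswap m')) h).
rewrite (reindex (@pswap P' P)) /=; last exact: onW_bij (pswap_bij _ _).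
by apply: eq_bigr => m _; rewrite (reindex (@pswap P' P)) //=; exact: onW_bij (pswap_bij _ _).
Qed.

Lemma sum_pair_mul (P P' : finType) (f : P -> P -> C) (g : P' -> P' -> C) :
  \sum_(m : P * P') \sum_(m' : P * P') f m.1 m'.1 * g m.2 m'.2 =
  (\sum_p \sum_p' f p p') * (\sum_q \sum_q' g q q').
Proof.
rewrite sum_pair big_distrlr /=; apply: eq_bigr => p _; apply: eq_bigr => q _.
by rewrite sum_pair big_distrlr.
Qed.

Lemma sum_push (A M : finType) (S : M -> M -> C) (G : A -> M -> M -> C) :
  \sum_a \sum_m \sum_m' S m m' * G a m m' =
  \sum_m \sum_m' S m m' * \sum_a G a m m'.
Proof.
rewrite exchange_big; apply: eq_bigr => m _ /=.
by rewrite exchange_big; apply: eq_bigr => m' _ /=; rewrite mulr_sumr.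
Qed.

Section Cut.
Variables X Y Z : finType.
Local Notation T := (X * Y * Z)%type.

(* The network in which the source shared by the first two parties is cut:
   it emits two independent systems with the same reduced states. *)
Lemma triangle_kernel_cut (K : T -> T -> C) : triangle_kernel K ->
  exists tau : T -> T -> C,
  [/\ gram tau,
      forall a b a' b', marg12 tau a b a' b' = marg1 K a a' * marg2 K b b',
      forall a c a' c', marg13 tau a c a' c' = marg13 K a c a' c' &
      forall b c b' c', marg23 tau b c b' c' = marg23 K b c b' c'].
Proof.
case=> P [P' [Q [Q' [R [R' [SM [SL [SN [JX [JY [JZ]]]]]]]]]]].
case=> -[[gM trM] [gL trL] [gN trN]] [[gX JXE] [gY JYE] [gZ JZE]] KE.
pose U := ((Q * Q') * (R * R'))%type.
pose SU (u u' : U) := SL u.1 u'.1 * SN u.2 u'.2.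
(* The network with the source [SM] removed and its two outputs left open. *)
pose G a b c a' b' c' (m m' : P * P') := \sum_(u : U) \sum_(u' : U) SU u u' *
  (JX (m.1, u.1.1, a) (m'.1, u'.1.1, a') * JY (m.2, u.2.1, b) (m'.2, u'.2.1, b') *
   JZ (u.1.2, u.2.2, c) (u'.1.2, u'.2.2, c')).
have {}KE a b c a' b' c' : K (a, b, c) (a', b', c') =
    \sum_m \sum_m' SM m m' * G a b c a' b' c' m m'.
  rewrite KE (reindex (fun mu : (P * P') * U => (mu.1, mu.2.1, mu.2.2))) /=; last first.
    by apply: onW_bij; exists (fun w => (w.1.1, (w.1.2, w.2))) => [[? []]|[[]]].
  rewrite sum_pair; apply: eq_bigr => m _.
  rewrite [RHS](eq_bigr (fun m' => \sum_(u : U) \sum_(u' : U) SM m m' * (SU u u' *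
  (JX (m.1, u.1.1, a) (m'.1, u'.1.1, a') * JY (m.2, u.2.1, b) (m'.2, u'.2.1, b') *
   JZ (u.1.2, u.2.2, c) (u'.1.2, u'.2.2, c'))))); last first.
    by move=> m' _; rewrite mulr_sumr; apply: eq_bigr => u _; rewrite mulr_sumr.
  rewrite [RHS]exchange_big; apply: eq_bigr => u _ /=.
  rewrite (reindex (fun mu : (P * P') * U => (mu.1, mu.2.1, mu.2.2))) /=; last first.
    by apply: onW_bij; exists (fun w => (w.1.1, (w.1.2, w.2))) => [[? []]|[[]]].
  by rewrite pair_bigA; apply: eq_bigr => mu _; rewrite /SU /=; ring.
(* Tracing out the second party turns its channel into deltas on its inputs; [H2] is what is left of
   [G] besides the delta on its half of [SM]. [H1] does the same for the first party. *)
pose H2 a c a' c' (p p' : P) := \sum_(u : U) \sum_(u' : U) SU u u' *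
  ((u.2.1 == u'.2.1)%:R * (JX (p, u.1.1, a) (p', u'.1.1, a') *
   JZ (u.1.2, u.2.2, c) (u'.1.2, u'.2.2, c'))).
pose H1 b c b' c' (p p' : P') := \sum_(u : U) \sum_(u' : U) SU u u' *
  ((u.1.1 == u'.1.1)%:R * (JY (p, u.2.1, b) (p', u'.2.1, b') *
   JZ (u.1.2, u.2.2, c) (u'.1.2, u'.2.2, c'))).
(* Tracing out the third party disconnects the remaining two: [G] splits into [A] and [B], each a
   channel fed by one half of [SM] and by half of another source. *)
pose A a a' p p' := \sum_l \sum_l' SL l l' *
  ((l.2 == l'.2)%:R * JX (p, l.1, a) (p', l'.1, a')).
pose B b b' p p' := \sum_n \sum_n' SN n n' *
  ((n.2 == n'.2)%:R * JY (p, n.1, b) (p', n'.1, b')).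
have HG2 a c a' c' m m' : \sum_b G a b c a' b c' m m'
    = (m.2 == m'.2)%:R * H2 a c a' c' m.1 m'.1.
  rewrite sum_push mulr_sumr; apply: eq_bigr => u _.
  rewrite mulr_sumr; apply: eq_bigr => u' _.
  by rewrite -mulr_suml -mulr_sumr JYE xpair_eqE -mulnb natrM; ring.
have HG1 b c b' c' m m' : \sum_a G a b c a b' c' m m'
    = (m.1 == m'.1)%:R * H1 b c b' c' m.2 m'.2.
  rewrite sum_push mulr_sumr; apply: eq_bigr => u _.
  rewrite mulr_sumr; apply: eq_bigr => u' _.
  by rewrite -!mulr_suml JXE xpair_eqE -mulnb natrM; ring.
have HG3 a b a' b' m m' : \sum_c G a b c a' b' c m m'
    = A a a' m.1 m'.1 * B b b' m.2 m'.2.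
  rewrite sum_push -(sum_pair_mul
    (fun l l' => SL l l' * ((l.2 == l'.2)%:R * JX (m.1, l.1, a) (m'.1, l'.1, a')))
    (fun n n' => SN n n' * ((n.2 == n'.2)%:R * JY (m.2, n.1, b) (m'.2, n'.1, b')))).
  apply: eq_bigr => u _; apply: eq_bigr => u' _.
  by rewrite -!mulr_sumr JZE xpair_eqE -mulnb natrM /SU; ring.
have trE (V W : finType) (S : V * W -> V * W -> C) :
    \sum_m \sum_m' S m m' * ((m.2 == m'.2)%:R * (m.1 == m'.1)%:R) = \sum_m S m m.
  apply: eq_bigr => m _; rewrite -(sum_delta m (fun m' => S m m')).
  apply: eq_bigr => m' _; rewrite eq_sym (eq_sym _ m'.1) -natrM mulnb andbC.
  by rewrite -xpair_eqE -!surjective_pairing mulrC.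
(* [A] preserves the trace, because [JX] does and [SL] has unit trace; likewise [B]. *)
have AE p p' : \sum_a A a a p p' = (p == p')%:R.
  rewrite sum_push -[RHS]mulr1 -trL -trE mulr_sumr; apply: eq_bigr => l _.
  rewrite mulr_sumr; apply: eq_bigr => l' _.
  by rewrite -mulr_sumr JXE xpair_eqE -mulnb natrM; ring.
have BE p p' : \sum_b B b b p p' = (p == p')%:R.
  rewrite sum_push -[RHS]mulr1 -trN -trE mulr_sumr; apply: eq_bigr => n _.
  rewrite mulr_sumr; apply: eq_bigr => n' _.
  by rewrite -mulr_sumr JYE xpair_eqE -mulnb natrM; ring.
(* The cut: in [tau], [SM] is replaced by the product of its two reduced kernels. *)
pose S1 p p' := \sum_q SM (p, q) (p', q).
pose S2 q q' := \sum_p SM (p, q) (p, q').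
pose tau (s t : T) := \sum_m \sum_m' (S1 m.1 m'.1 * S2 m.2 m'.2) *
  G s.1.1 s.1.2 s.2 t.1.1 t.1.2 t.2 m m'.
have S1E : \sum_p S1 p p = 1 by rewrite -trM pair_bigA; apply: eq_bigr => -[].
have S2E : \sum_q S2 q q = 1.
  by rewrite exchange_big -trM pair_bigA; apply: eq_bigr => -[].
exists tau; split.
(* [tau] is obtained from products of pullbacks of Gram kernels by contracting first [u], inside
   [G], and then [m]. *)
- apply: (@gram_contract _ _ (P * P' * T)%type _ (fun m s => (m, s))
    (fun x y => (S1 x.1.1 y.1.1 * S2 x.1.2 y.1.2) *
      G x.2.1.1 x.2.1.2 x.2.2 y.2.1.1 y.2.1.2 y.2.2 x.1 y.1)).
  have gS1 : gram S1 by apply: (gram_trace (fun q p => (p, q))).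
  have gS2 : gram S2 by apply: (gram_trace (fun q p => (q, p))).
  apply: gramM; first apply: gramM.
  + exact: (gram_pullback (fun x : P * P' * T => x.1.1) gS1).
  + exact: (gram_pullback (fun x : P * P' * T => x.1.2) gS2).
  apply: (@gram_contract _ _ (U * (P * P' * T))%type _ (fun u x => (u, x))
    (fun x y => SU x.1 y.1 *
      (JX (x.2.1.1, x.1.1.1, x.2.2.1.1) (y.2.1.1, y.1.1.1, y.2.2.1.1) *
       JY (x.2.1.2, x.1.2.1, x.2.2.1.2) (y.2.1.2, y.1.2.1, y.2.2.1.2) *
       JZ (x.1.1.2, x.1.2.2, x.2.2.2) (y.1.1.2, y.1.2.2, y.2.2.2)))).
  apply: gramM; first apply: gramM.
  + exact: (gram_pullback (fun x : U * (P * P' * T) => x.1.1) gL).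
  + exact: (gram_pullback (fun x : U * (P * P' * T) => x.1.2) gN).
  apply: gramM; first apply: gramM.
  + exact: (gram_pullback (fun x : U * (P * P' * T) => (x.2.1.1, x.1.1.1, x.2.2.1.1)) gX).
  + exact: (gram_pullback (fun x : U * (P * P' * T) => (x.2.1.2, x.1.2.1, x.2.2.1.2)) gY).
  + exact: (gram_pullback (fun x : U * (P * P' * T) => (x.1.1.2, x.1.2.2, x.2.2.2)) gZ).
(* Without the third party everything factors: each single marginal of [K] is a reduced kernel of
   [SM] sent through [A] or [B], and [tau] carries the product of the two. *)
- move=> a b a' b'.
  have -> : marg1 K a a' = \sum_p \sum_p' S1 p p' * A a a' p p'.
    rewrite -sum_pair_delta2 /marg1.
    under eq_bigr => b1 _ do (under eq_bigr => c _ do rewrite KE; rewrite sum_push).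
    rewrite sum_push; apply: eq_bigr => m _; apply: eq_bigr => m' _.
    under eq_bigr => b1 _ do rewrite HG3.
    by rewrite -mulr_sumr BE [A _ _ _ _ * _]mulrC.
  have -> : marg2 K b b' = \sum_q \sum_q' S2 q q' * B b b' q q'.
    rewrite -sum_pair_delta1 /marg2.
    under eq_bigr => a1 _ do (under eq_bigr => c _ do rewrite KE; rewrite sum_push).
    rewrite sum_push; apply: eq_bigr => m _; apply: eq_bigr => m' _.
    under eq_bigr => a1 _ do rewrite HG3.
    by rewrite -mulr_suml AE.
  rewrite -sum_pair_mul /marg12 /tau sum_push.
  by apply: eq_bigr => m _; apply: eq_bigr => m' _; rewrite HG3; ring.
(* Once the second party is traced out, both [SM] and its cut version enter through the same reduced
   kernel [S1], since [S2] has unit trace. *)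
- move=> a c a' c'; rewrite /marg13 /tau sum_push.
  under [RHS]eq_bigr => b _ do rewrite KE.
  rewrite sum_push /=.
  under eq_bigr => m _ do under eq_bigr => m' _ do rewrite HG2.
  under [RHS]eq_bigr => m _ do under eq_bigr => m' _ do rewrite HG2.
  rewrite (sum_pair_delta2 (fun m m' => S1 m.1 m'.1 * S2 m.2 m'.2)) sum_pair_delta2.
  by apply: eq_bigr => p _; apply: eq_bigr => p' _; rewrite /= -mulr_sumr S2E mulr1.
- move=> b c b' c'; rewrite /marg23 /tau sum_push.
  under [RHS]eq_bigr => a _ do rewrite KE.
  rewrite sum_push /=.
  under eq_bigr => m _ do under eq_bigr => m' _ do rewrite HG1.
  under [RHS]eq_bigr => m _ do under eq_bigr => m' _ do rewrite HG1.
  rewrite (sum_pair_delta1 (fun m m' => S1 m.1 m'.1 * S2 m.2 m'.2)) sum_pair_delta1.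
  by apply: eq_bigr => p _; apply: eq_bigr => p' _; rewrite /= -mulr_suml S1E mul1r.
Qed.

(** [Ikernel] with the trace set to 1 and the marginal of the first two parties replaced by the
    product of their single marginals. *)
Definition Itriangle (K : T -> T -> C) (s t : T) : C :=
  let: (a, b, c) := s in let: (a', b', c') := t in
  let da := (a == a')%:R in let db := (b == b')%:R in let dc := (c == c')%:R in
  da * db * dc
  - marg1 K a a' * db * dc - marg2 K b b' * da * dc - marg3 K c c' * da * db
  + marg1 K a a' * marg2 K b b' * dc + marg13 K a c a' c' * db
  + marg23 K b c b' c' * da.

Lemma Itriangle_conj (K : T -> T -> C) s t :
  (forall s t, (K s t)^* = K t s) -> (Itriangle K s t)^* = Itriangle K t s.
Proof.
move=> KJ; case: s t => [[a b] c] [[a' b'] c'].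
have m1 i j : (marg1 K i j)^* = marg1 K j i.
  by rewrite rmorph_sum; apply: eq_bigr => p _; rewrite rmorph_sum;
    apply: eq_bigr => q _; apply: KJ.
have m2 i j : (marg2 K i j)^* = marg2 K j i.
  by rewrite rmorph_sum; apply: eq_bigr => p _; rewrite rmorph_sum;
    apply: eq_bigr => q _; apply: KJ.
have m3 i j : (marg3 K i j)^* = marg3 K j i.
  by rewrite rmorph_sum; apply: eq_bigr => p _; rewrite rmorph_sum;
    apply: eq_bigr => q _; apply: KJ.
have m13 i j i' j' : (marg13 K i j i' j')^* = marg13 K i' j' i j.
  by rewrite rmorph_sum; apply: eq_bigr => p _; apply: KJ.
have m23 i j i' j' : (marg23 K i j i' j')^* = marg23 K i' j' i j.
  by rewrite rmorph_sum; apply: eq_bigr => p _; apply: KJ.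
rewrite /Itriangle !(rmorphD, rmorphN, rmorphM) /= !rmorph_nat m1 m2 m3 m13 m23.
by rewrite (eq_sym a') (eq_sym b') (eq_sym c').
Qed.

(** [Itriangle K] equals [Ikernel tau] for the cut kernel [tau]: the single marginals and the trace
    of [tau] agree with those of [K] because its pair marginals with the third party do. *)
Lemma Itriangle_form_ge0 (K : T -> T -> C) (v : T -> C) :
  triangle_kernel K -> \sum_i K i i = 1 ->
  0 <= \sum_s \sum_t (v s)^* * Itriangle K s t * v t.
Proof.
move=> /triangle_kernel_cut [tau [gtau t12 t13 t23]] trK.
have t1 a a' : marg1 tau a a' = marg1 K a a'.
  by rewrite /marg1 exchange_big [RHS]exchange_big; apply: eq_bigr => c _; apply: t13.
have t2 b b' : marg2 tau b b' = marg2 K b b'.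
  by rewrite /marg2 exchange_big [RHS]exchange_big; apply: eq_bigr => c _; apply: t23.
have t3 c c' : marg3 tau c c' = marg3 K c c'.
  by apply: eq_bigr => a _; apply: t13.
have trtau : \sum_i tau i i = 1.
  by rewrite -trK !sum_triple; apply: eq_bigr => a _; apply: t1.
have := Ikernel_form_ge0 v gtau.
congr (0 <= _); apply: eq_bigr => -[[a b] c] _; apply: eq_bigr => -[[a' b'] c'] _.
by rewrite /Ikernel /Itriangle trtau t1 t2 t3 t12 t13 t23 mulr1.
Qed.

End Cut.
End Network.

(** * From matrices to kernels *)

Section Matrices.
Variable C : numClosedFieldType.

Lemma sum_mxtens m n (F : 'I_(m * n) -> C) :
  \sum_k F k = \sum_(ij : 'I_m * 'I_n) F (mxtens_index ij).
Proof.
by rewrite (reindex (@mxtens_index m n)) //; exists (@mxtens_unindex m n) => k _;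
  rewrite (mxtens_indexK, mxtens_unindexK).
Qed.

Lemma mxtens_index_eq m n (s t : 'I_m * 'I_n) :
  (mxtens_index s == mxtens_index t) = (s == t).
Proof. exact: inj_eq (can_inj (@mxtens_indexK m n)) _ _. Qed.

Lemma tensmapE m m' n n' (E : 'M[C]_m -> 'M[C]_m') (F : 'M[C]_n -> 'M[C]_n')
    (X : 'M[C]_(m * n)) a b a' b' :
  tensmap E F X (mxtens_index (a, b)) (mxtens_index (a', b')) =
  \sum_(s : 'I_m * 'I_n) \sum_(t : 'I_m * 'I_n)
    X (mxtens_index s) (mxtens_index t) *
      (E (delta_mx s.1 t.1) a a' * F (delta_mx s.2 t.2) b b').
Proof.
rewrite sum_pair /tensmap summxE; apply: eq_bigr => i _.
rewrite summxE (eq_bigr (fun k => \sum_(j < m) \sum_(l < n)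
  X (mxtens_index (i, k)) (mxtens_index (j, l)) *
   (E (delta_mx i j) a a' * F (delta_mx k l) b b'))); last first.
  by move=> k _; rewrite sum_pair.
rewrite [RHS]exchange_big; apply: eq_bigr => j _ /=.
rewrite summxE; apply: eq_bigr => k _; rewrite summxE; apply: eq_bigr => l _.
by rewrite 2!mxE !mxtens_indexK.
Qed.

Lemma sum_pair_delta_mx (S : finType) (s0 t0 : S) (F : S -> S -> C) :
  \sum_s \sum_t ((s == s0) && (t == t0))%:R * F s t = F s0 t0.
Proof.
rewrite -[RHS](sum_delta s0 (fun s => F s t0)); apply: eq_bigr => s _.
rewrite -[in RHS](sum_delta t0 (F s)) mulr_sumr; apply: eq_bigr => t _.
by rewrite -mulnb natrM mulrA.
Qed.

Lemma tensmap_delta m m' n n' (E : 'M[C]_m -> 'M[C]_m') (F : 'M[C]_n -> 'M[C]_n')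
    s0 t0 a b a' b' :
  tensmap E F (delta_mx (mxtens_index s0) (mxtens_index t0))
    (mxtens_index (a, b)) (mxtens_index (a', b')) =
  E (delta_mx s0.1 t0.1) a a' * F (delta_mx s0.2 t0.2) b b'.
Proof.
rewrite tensmapE -[RHS](sum_pair_delta_mx s0 t0
  (fun s t => E (delta_mx s.1 t.1) a a' * F (delta_mx s.2 t.2) b b')).
by apply: eq_bigr => s _; apply: eq_bigr => t _; rewrite mxE !mxtens_index_eq.
Qed.

(** The unnormalized projection onto the maximally entangled vector, the sum of all [e_i] tensor
    [e_i]. Letting a map act on its first factor yields the Choi matrix. *)
Definition max_entangled m : 'M[C]_(m * m) :=
  \matrix_(k, l) (((mxtens_unindex k).1 == (mxtens_unindex k).2) &&
                  ((mxtens_unindex l).1 == (mxtens_unindex l).2))%:R.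

Lemma formE n (X : 'M[C]_n) (v : 'cV[C]_n) :
  (v ^t* *m X *m v) 0 0 = \sum_s \sum_t (v s 0)^* * X s t * v t 0.
Proof.
rewrite exchange_big mxE; apply: eq_bigr => t _ /=.
by rewrite mxE mulr_suml; apply: eq_bigr => s _; rewrite !mxE.
Qed.

Lemma psd_max_entangled m : psd (max_entangled m).
Proof.
split; first by apply/matrixP=> k l; rewrite !mxE rmorph_nat andbC.
move=> v; rewrite formE.
pose w (k : 'I_(m * m)) : C := ((mxtens_unindex k).1 == (mxtens_unindex k).2)%:R.
have -> : \sum_s \sum_t (v s 0)^* * max_entangled m s t * v t 0 =
    (\sum_s w s * v s 0) * (\sum_s w s * v s 0)^*.
  rewrite mulrC rmorph_sum big_distrlr; apply: eq_bigr => s _; apply: eq_bigr => t _ /=.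
  by rewrite rmorphM /= mxE /w rmorph_nat -mulnb natrM; ring.
exact: mul_conjC_ge0.
Qed.

(** One direction of Choi's theorem. The image of [max_entangled] has the output index before the
    input index, hence the pullback along the exchange of the two. *)
Lemma completely_positive_gram m n (E : {linear 'M[C]_m -> 'M[C]_n}) :
  completely_positive E ->
  gram (fun s t : 'I_m * 'I_n => E (delta_mx s.1 t.1) s.2 t.2).
Proof.
move=> /(_ m _ (psd_max_entangled m)) /psd_gram.
move=> /(gram_pullback (fun s : 'I_m * 'I_n => mxtens_index (s.2, s.1))).
apply: eq_gram => -[i a] [j b] /=; rewrite tensmapE.
rewrite -[RHS](sum_pair_delta_mx (i, i) (j, j) (fun s t => E (delta_mx s.1 t.1) a b)).
apply: eq_bigr => -[s1 s2] _; apply: eq_bigr => -[t1 t2] _ /=.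
rewrite !mxE !mxtens_indexK /= !xpair_eqE [_ * (E _ _ _ * _)]mulrCA mulrC -natrM mulnb.
congr (_%:R * _); have [->|_] := eqVneq i s2; last by rewrite !andbF.
by have [->|_] := eqVneq j t2; rewrite ?andbF ?andbT.
Qed.

Lemma channel_choi m n (E : {linear 'M[C]_m -> 'M[C]_n}) : channel E ->
  choi_channel (fun s t : 'I_m * 'I_n => E (delta_mx s.1 t.1) s.2 t.2).
Proof.
case=> /completely_positive_gram gE trE; split=> // i j /=.
have := trE (delta_mx i j); rewrite /mxtrace => ->.
rewrite -(sum_delta i (fun k => (k == j)%:R : C)).
by apply: eq_bigr => k _; rewrite mxE -natrM mulnb.
Qed.

Lemma state_unit_trace_gram m n (X : 'M[C]_(m * n)) : is_state X ->
  unit_trace_gram (fun s t : 'I_m * 'I_n => X (mxtens_index s) (mxtens_index t)).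
Proof.
case=> /psd_gram gX trX; split; first exact: (gram_pullback (@mxtens_index m n) gX).
by rewrite -trX /mxtrace sum_mxtens.
Qed.

Definition index3 a b c (s : 'I_a * 'I_b * 'I_c) : 'I_(a * b * c) :=
  mxtens_index (mxtens_index s.1, s.2).

Lemma triangle_index_mxtens la lc ma mb nb nc (q : 'I_la) (q' : 'I_lc)
    (p : 'I_ma) (p' : 'I_mb) (r : 'I_nb) (r' : 'I_nc) :
  triangle_index (mxtens_index (mxtens_index (mxtens_index (q, p),
    mxtens_index (p', r)), mxtens_index (q', r'))) =
  mxtens_index (mxtens_index (mxtens_index (q, q'), mxtens_index (p, p')),
    mxtens_index (r, r')).
Proof. by rewrite /triangle_index; do 5 (rewrite mxtens_indexK; lazy beta iota). Qed.

Lemma triangle_compatible_kernel a b c (rho : 'M[C]_(a * b * c)) :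
  triangle_compatible rho ->
  triangle_kernel (fun s t => rho (index3 s) (index3 t)).
Proof.
case=> la [lc [ma [mb [nb [nc [sL [sM [sN [EA [EB [EC]]]]]]]]]]].
case=> -[hL hM hN] [hA hB hC] ->.
exists 'I_ma, 'I_mb, 'I_la, 'I_lc, 'I_nb, 'I_nc,
  (fun s t => sM (mxtens_index s) (mxtens_index t)),
  (fun s t => sL (mxtens_index s) (mxtens_index t)),
  (fun s t => sN (mxtens_index s) (mxtens_index t)),
  (* [EA] reads its share of L before that of M, while the first channel of [triangle_kernel] reads
     M first. *)
  (fun s t => EA (delta_mx (mxtens_index (pswap s.1)) (mxtens_index (pswap t.1))) s.2 t.2),
  (fun s t => EB (delta_mx (mxtens_index s.1) (mxtens_index t.1)) s.2 t.2),
  (fun s t => EC (delta_mx (mxtens_index s.1) (mxtens_index t.1)) s.2 t.2); split.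
- by split; apply: state_unit_trace_gram.
- split.
  + apply: (choi_channel_pullback (h := fun s => mxtens_index (pswap s)) _ (channel_choi hA)).
    exact: inj_comp (can_inj (@mxtens_indexK _ _)) (bij_inj (pswap_bij _ _)).
  + exact: (choi_channel_pullback (can_inj (@mxtens_indexK _ _)) (channel_choi hB)).
  + exact: (choi_channel_pullback (can_inj (@mxtens_indexK _ _)) (channel_choi hC)).
move=> ia ib ic ia' ib' ic'; rewrite /index3 tensmapE /=.
(* The regrouping from source indices to the inputs of the three channels. *)
pose h (w : ('I_ma * 'I_mb) * ('I_la * 'I_lc) * ('I_nb * 'I_nc)) :
    'I_(la * ma * (mb * nb)) * 'I_(lc * nc) :=
  (mxtens_index (mxtens_index (w.1.2.1, w.1.1.1), mxtens_index (w.1.1.2, w.2.1)),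
   mxtens_index (w.1.2.2, w.2.2)).
have hb : bijective h.
  pose g (k : 'I_(la * ma * (mb * nb)) * 'I_(lc * nc)) :=
    let kA := mxtens_unindex (mxtens_unindex k.1).1 in
    let kB := mxtens_unindex (mxtens_unindex k.1).2 in
    let kC := mxtens_unindex k.2 in
    ((kA.2, kB.1), (kA.1, kC.1), (kB.2, kC.2)).
  exists g; first by case=> -[[p p'] [q q']] [r r']; rewrite /g /h !mxtens_indexK.
  case=> k k'; case: (mxtens_indexP k') => q' r'; case: (mxtens_indexP k) => kA kB;
    case: (mxtens_indexP kA) => q p; case: (mxtens_indexP kB) => p' r;
    by rewrite /g /h !mxtens_indexK.
rewrite (reindex h) /=; last exact: onW_bij.
apply: eq_bigr => -[[[p p'] [q q']] [r r']] _; rewrite (reindex h) /=; last exact: onW_bij.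
apply: eq_bigr => -[[[u u'] [v v']] [w w']] _ /=.
rewrite tensmap_delta /= mxE !triangle_index_mxtens 2!mxE !mxtens_indexK /=.
rewrite /pswap /=; ring.
Qed.

(** * Partial traces and the operator of the theorem in coordinates *)

Lemma ptraceE n m r (keep : 'I_n -> 'I_m) (out : 'I_n -> 'I_r)
    (join : 'I_m -> 'I_r -> 'I_n) (X : 'M[C]_n) i j :
  (forall i o, keep (join i o) = i) -> (forall i o, out (join i o) = o) ->
  (forall k, join (keep k) (out k) = k) ->
  ptrace keep out X i j = \sum_o X (join i o) (join j o).
Proof.
move=> keepK outK joinK; rewrite mxE; apply: eq_bigr => o _.
have joinE i0 k : (keep k == i0) && (out k == o) = (k == join i0 o).
  apply/andP/eqP => [[/eqP <- /eqP <-]|->]; first by rewrite joinK.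
  by rewrite keepK outK !eqxx.
rewrite (eq_bigl _ _ (joinE i)) big_pred1_eq.
by rewrite (eq_bigl _ _ (joinE j)) big_pred1_eq.
Qed.

Lemma on1E (d : party -> nat) (x y z : party) (X : 'M[C]_(d x)) k l :
  on1 y z X k l = X (factor x k) (factor x l) *
    (factor y k == factor y l)%:R * (factor z k == factor z l)%:R.
Proof. by rewrite /on1 /toABC mxE !tensmxE !mxE. Qed.

Lemma on2E (d : party -> nat) (x y z : party) (X : 'M[C]_(d x * d y)) k l :
  on2 z X k l = X (factor2 x y k) (factor2 x y l) * (factor z k == factor z l)%:R.
Proof. by rewrite /on2 /toABC mxE tensmxE !mxE. Qed.

Section Parties.
Variables (d : party -> nat) (x y z : party).
Local Notation dABC := (d partyA * d partyB * d partyC)%N.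
Local Notation T := ('I_(d x) * 'I_(d y) * 'I_(d z))%type.
(** The numbering of the basis of the whole space by the indices of x, y and z in this order.
    Leaving it abstract treats all six orders of the parties at once. *)
Variable idx : T -> 'I_dABC.
Hypothesis factor_x : forall s, factor x (idx s) = s.1.1.
Hypothesis factor_y : forall s, factor y (idx s) = s.1.2.
Hypothesis factor_z : forall s, factor z (idx s) = s.2.
Hypothesis idx_factor : forall k, idx (factor x k, factor y k, factor z k) = k.

Lemma idx_bij : bijective idx.
Proof.
exists (fun k => (factor x k, factor y k, factor z k)) => // s.
by rewrite factor_x factor_y factor_z -!surjective_pairing.
Qed.

Lemma Ixy_kernel (rho : 'M[C]_dABC) s t :
  Ixy x y z rho (idx s) (idx t) =
  Itriangle (fun s t => rho (idx s) (idx t)) s t.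
Proof.
case: s t => [[a b] c] [[a' b'] c'].
pose K (s t : T) := rho (idx s) (idx t).
have idxK k a0 b0 c0 : factor x k = a0 -> factor y k = b0 -> factor z k = c0 ->
  idx (a0, b0, c0) = k by move=> <- <- <-.
have r1 i j : reduced1 x y z rho i j = marg1 K i j.
  rewrite /reduced1 (ptraceE (join := fun i o => idx (i, (mxtens_unindex o).1, (mxtens_unindex o).2))).
  - by rewrite sum_mxtens sum_pair; apply: eq_bigr => p _; apply: eq_bigr => q _;
      rewrite !mxtens_indexK.
  - by move=> *; rewrite factor_x.
  - by move=> *; rewrite /factor2 factor_y factor_z -surjective_pairing mxtens_unindexK.
  - by move=> k; rewrite /factor2 mxtens_indexK; apply: idxK.
have r2 i j : reduced1 y x z rho i j = marg2 K i j.
  rewrite /reduced1 (ptraceE (join := fun i o => idx ((mxtens_unindex o).1, i, (mxtens_unindex o).2))).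
  - by rewrite sum_mxtens sum_pair; apply: eq_bigr => p _; apply: eq_bigr => q _;
      rewrite !mxtens_indexK.
  - by move=> *; rewrite factor_y.
  - by move=> *; rewrite /factor2 factor_x factor_z -surjective_pairing mxtens_unindexK.
  - by move=> k; rewrite /factor2 mxtens_indexK; apply: idxK.
have r3 i j : reduced1 z x y rho i j = marg3 K i j.
  rewrite /reduced1 (ptraceE (join := fun i o => idx ((mxtens_unindex o).1, (mxtens_unindex o).2, i))).
  - by rewrite sum_mxtens sum_pair; apply: eq_bigr => p _; apply: eq_bigr => q _;
      rewrite !mxtens_indexK.
  - by move=> *; rewrite factor_z.
  - by move=> *; rewrite /factor2 factor_x factor_y -surjective_pairing mxtens_unindexK.
  - by move=> k; rewrite /factor2 mxtens_indexK; apply: idxK.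
have r13 p q p' q' : reduced2 x z y rho (mxtens_index (p, q)) (mxtens_index (p', q'))
    = marg13 K p q p' q'.
  rewrite /reduced2 (ptraceE (join := fun i o => idx ((mxtens_unindex i).1, o, (mxtens_unindex i).2))).
  - by apply: eq_bigr => o _; rewrite !mxtens_indexK.
  - by move=> *; rewrite /factor2 factor_x factor_z -surjective_pairing mxtens_unindexK.
  - by move=> *; rewrite factor_y.
  - by move=> k; rewrite /factor2 mxtens_indexK; apply: idxK.
have r23 p q p' q' : reduced2 y z x rho (mxtens_index (p, q)) (mxtens_index (p', q'))
    = marg23 K p q p' q'.
  rewrite /reduced2 (ptraceE (join := fun i o => idx (o, (mxtens_unindex i).1, (mxtens_unindex i).2))).
  - by apply: eq_bigr => o _; rewrite !mxtens_indexK.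
  - by move=> *; rewrite /factor2 factor_y factor_z -surjective_pairing mxtens_unindexK.
  - by move=> *; rewrite factor_x.
  - by move=> k; rewrite /factor2 mxtens_indexK; apply: idxK.
have idx_eq : (idx (a, b, c) == idx (a', b', c'))%:R
    = (a == a')%:R * (b == b')%:R * (c == c')%:R :> C.
  by rewrite (bij_eq idx_bij) !xpair_eqE -!mulnb !natrM.
have addE (A B : 'M[C]_dABC) k l : (A + B) k l = A k l + B k l by rewrite mxE.
have oppE (A : 'M[C]_dABC) k l : (- A) k l = - A k l by rewrite mxE.
have oneE k l : (1%:M : 'M[C]_dABC) k l = (k == l)%:R by rewrite mxE.
rewrite /Ixy !addE !oppE oneE.
rewrite !on1E !on2E /factor2 !factor_x !factor_y !factor_z tensmxE.
by rewrite r1 r2 r3 r13 r23 idx_eq.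
Qed.

Lemma psd_Ixy (rho : 'M[C]_dABC) : is_state rho ->
  triangle_kernel (fun s t => rho (idx s) (idx t)) -> psd (Ixy x y z rho).
Proof.
move=> [[rhoH _] tr_rho] Ktri; have [fct idxK fctK] := idx_bij.
split.
  apply/matrixP=> k l; rewrite 2!mxE -(fctK k) -(fctK l) !Ixy_kernel.
  apply: Itriangle_conj => s t.
  by rewrite -[in RHS]rhoH 2!mxE.
move=> v; rewrite formE (reindex idx) /=; last exact: onW_bij idx_bij.
have := Itriangle_form_ge0 (fun s => v (idx s) 0) Ktri.
have -> : \sum_i rho (idx i) (idx i) = 1.
  by rewrite -tr_rho /mxtrace (reindex idx) //=; apply: onW_bij idx_bij.
move=> /(_ erefl); congr (0 <= _); apply: eq_bigr => s _.
rewrite [RHS](reindex idx) /=; last exact: onW_bij idx_bij.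
by apply: eq_bigr => t _; rewrite Ixy_kernel.
Qed.

End Parties.
End Matrices.

Local Open Scope complex_scope.

Theorem mainTheorem4 (R : realType) (d : party -> nat)
    (rho : 'M[R[i]]_(d partyA * d partyB * d partyC))
    (rho_state : is_state rho) (rho_triangle : triangle_compatible rho)
    (x y z : party) (xy : x <> y) (xz : x <> z) (yz : y <> z) :
  psd (Ixy x y z rho).
Proof.
have ABC := triangle_compatible_kernel rho_triangle.
(* Adjacent transpositions lead from the order A, B, C to the five others; in each case below, [idx]
   puts the three indices back in the order A, B, C. *)
have BAC := triangle_kernel_swap12 ABC; have ACB := triangle_kernel_swap23 ABC.
have BCA := triangle_kernel_swap23 BAC; have CAB := triangle_kernel_swap12 ACB.
have CBA := triangle_kernel_swap12 BCA.
have fA s : factor (d := d) partyA (index3 s) = s.1.1.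
  by rewrite /factor /index3 !mxtens_indexK.
have fB s : factor (d := d) partyB (index3 s) = s.1.2.
  by rewrite /factor /index3 !mxtens_indexK.
have fC s : factor (d := d) partyC (index3 s) = s.2.
  by rewrite /factor /index3 !mxtens_indexK.
have fK k : index3 (factor (d := d) partyA k, factor partyB k, factor partyC k) = k.
  case: (mxtens_indexP k) => ab c; case: (mxtens_indexP ab) => a b.
  by rewrite /factor !mxtens_indexK.
case: x y z xy xz yz => [] [] [] // _ _ _.
- exact: (psd_Ixy (idx := @index3 _ _ _) fA fB fC fK rho_state ABC).
- exact: (psd_Ixy (idx := fun s => index3 (s.1.1, s.2, s.1.2))
    (fun s => fA _) (fun s => fC _) (fun s => fB _) fK rho_state ACB).
- exact: (psd_Ixy (idx := fun s => index3 (s.1.2, s.1.1, s.2))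
    (fun s => fB _) (fun s => fA _) (fun s => fC _) fK rho_state BAC).
- exact: (psd_Ixy (idx := fun s => index3 (s.2, s.1.1, s.1.2))
    (fun s => fB _) (fun s => fC _) (fun s => fA _) fK rho_state BCA).
- exact: (psd_Ixy (idx := fun s => index3 (s.1.2, s.2, s.1.1))
    (fun s => fC _) (fun s => fA _) (fun s => fB _) fK rho_state CAB).
- exact: (psd_Ixy (idx := fun s => index3 (s.2, s.1.2, s.1.1))
    (fun s => fC _) (fun s => fB _) (fun s => fA _) fK rho_state CBA).
Qed.
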